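(* Let $H=(V,\mathcal E,\psi_H)$ be a connected hypergraph with $N\ge2$ vertices whose edges have at most $r\ge2$ vertices, and let $\mu_2$ be the second smallest eigenvalue of the Laplacian $L_H$ of its weighted $2$-section. For every $\emptyset\ne S\subsetneq V$ we have $$|\delta_H(S)|\ge\frac{\mu_2}{\lfloor r^2/4\rfloor}\cdot\frac{|S|(N-|S|)}{N}.$$ Consequently, every hypergraphic additive code $\mathcal C$ (over $\mathbb F_{q^h}$, for a prime power $q$ and $h\ge1$) with underlying hypergraph $H$ satisfies $$d(\mathcal C)=\lambda(H)\ge\left\lceil\frac{\mu_2(N-1)}{N\lfloor r^2/4\rfloor}\right\rceil.$$
   Context: A finite hypergraph is a triple $H=(V,\mathcal E,\psi_H)$ with finite sets $V$, $\mathcal E$ and a map $\psi_H:\mathcal E\to2^V\setminus\{\emptyset\}$ (distinct edges may have the same vertex set; $e$ is identified with $\psi_H(e)$). Vertices are in the same component if joined by a walk $u_0,e_1,u_1,\ldots,e_\ell,u_\ell$ with $u_{i-1},u_i\in e_i$; $H$ is connected if it has one component. For $\emptyset\ne S\subsetneq V$, $\delta_H(S)$ is the set of edges meeting both $S$ and $V\setminus S$; $\lambda(H):=\min_{\emptyset\ne S\subsetneq V}|\delta_H(S)|$. For distinct $u,v\in V$ let $a_{uv}:=|\{e\in\mathcal E:u,v\in e\}|$, and $a_{uu}:=0$. Let $A_H=(a_{uv})$, let $D_H$ be the diagonal matrix with entries $\sum_{v\ne u}a_{uv}$, and $L_H:=D_H-A_H$ (Laplacian of the weighted $2$-section). Its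 eigenvalues, with multiplicity, are $0=\mu_1\le\mu_2\le\cdots\le\mu_N$. For $A\subseteq\mathcal E$, $\kappa(A)$ is the number of components of $(V,A,\psi_H|_A)$, isolated vertices included, and $f_H(A):=|V|-\kappa(A)$. An additive code $\mathcal C\subseteq\mathbb F_{q^h}^n$ is an $\mathbb F_q$-subspace, of $\mathbb F_q$-dimension $k$ say; $d(\mathcal C)$ is the minimum Hamming weight of a nonzero codeword. For $A\subseteq\{1,\ldots,n\}$, $\mathcal C(A)$ is the subspace of codewords vanishing on $A$ and $\rho_{\mathcal C}(A):=k-\dim_{\mathbb F_q}\mathcal C(A)$. $\mathcal C$ is hypergraphic with underlying hypergraph $H=(V,\{1,\ldots,n\},\psi_H)$ if no coordinate of $\mathcal C$ is identically zero and $\rho_{\mathcal C}=f_H$. *)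

(* Defs.v *)
From HB Require Import structures.
From mathcomp Require Import all_boot all_order all_algebra all_field.
From mathcomp Require Import spectral complex reals.

Set Implicit Arguments.
Unset Strict Implicit.
Unset Printing Implicit Defensive.

Import Order.TTheory GRing.Theory Num.Theory.
Local Open Scope ring_scope.

(* [H e] is the vertex set of the edge [e]; the map is not assumed injective. *)
Record hypergraph (V E : finType) := Hypergraph {
  edge_set :> E -> {set V};
  edge_set_neq0 : forall e, edge_set e != set0 }.

Section Hypergraph.
Variables V E : finType.
Implicit Types (H : hypergraph V E) (A : {set E}) (S : {set V}).

(* One step of a walk in the sub-hypergraph (V, A). *)
Definition adj H A : rel V :=
  [rel u v | [exists e in A, (u \in H e) && (v \in H e)]].

Lemma adj_connect_sym H A : connect_sym (adj H A).
Proof.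
apply: sym_connect_sym => u v; apply: eq_existsb => e.
by rewrite [(u \in _) && _]andbC.
Qed.

(* [n_comp] counts classes of the reflexive transitive closure on all of [V],
   so isolated vertices are included. *)
Definition kappa H A : nat := n_comp (adj H A) V.

Definition hconnected H : Prop := kappa H [set: E] = 1%N.

Definition graphic_rank H A : nat := (#|V| - kappa H A)%N.

Definition cut H S : {set E} :=
  [set e | (H e :&: S != set0) && (H e :&: ~: S != set0)].

(* The default value #|E| bounds every cut, so this is the true minimum as
   soon as #|V| >= 2, i.e. as soon as an admissible S exists. *)
Definition edge_connectivity H : nat :=
  \big[minn/#|E|]_(S : {set V} | (S != set0) && (S != setT)) #|cut H S|.

Definition codegree H (u v : V) : nat :=
  if u == v then 0%N else #|[set e | (u \in H e) && (v \in H e)]|.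

(* Vertices are enumerated by [enum_val] to index rows and columns. *)
Definition adjacency_mx (R : nzRingType) H : 'M[R]_#|V| :=
  \matrix_(i, j) (codegree H (enum_val i) (enum_val j))%:R.

Definition degree_mx (R : nzRingType) H : 'M[R]_#|V| :=
  diag_mx (\row_i \sum_(v | v != enum_val i) (codegree H (enum_val i) v)%:R).

Definition laplacian (R : nzRingType) H : 'M[R]_#|V| :=
  degree_mx R H - adjacency_mx R H.

End Hypergraph.

(* [mu] lists the eigenvalues of [M] with multiplicity, in increasing order. *)
Definition is_spectrum (R : realType) n (M : 'M[R]_n) (mu : seq R) : Prop :=
  sorted <=%R mu /\ char_poly M = \prod_(x <- mu) ('X - x%:P).

Lemma sym_spectrum_exists (R : realType) n (M : 'M[R]_n) :
  M^T = M -> exists mu, is_spectrum M mu.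
Proof.
move=> Msym; pose f := real_complex R; pose A := map_mx f M.
have Areal : A \is a realmx.
  by apply/mxOverP => i j; rewrite mxE complex_real.
have Aherm : A \is hermsymmx.
  apply: realsym_hermsym => //; apply/is_hermitianmxP.
  rewrite expr0 scale1r /A map_mx_id //.
  by rewrite map_trmx Msym.
have sp_real := hermitian_spectral_diag_real Aherm.
have [mu0 mu0E] : exists mu0 : 'rV[R]_n, spectral_diag A = map_mx f mu0.
  exists (map_mx (@complex.Re R) (spectral_diag A)).
  apply/rowP => i; rewrite !mxE /f RRe_real //.
  by move/mxOverP: sp_real; apply.
have /hermitian_normalmx/orthomx_spectralP AE := Aherm.
have charA : char_poly A = \prod_i ('X - (f (mu0 0 i))%:P).
  have Pu := spectral_unit A.
  have sim : char_poly A = char_poly (diag_mx (spectral_diag A)).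
    rewrite [in LHS]AE /char_poly /char_poly_mx.
    set P := spectralmx A in Pu *; set D := diag_mx _.
    have PV : map_mx polyC (invmx P) *m map_mx polyC P = 1%:M.
      by rewrite -map_mxM mulVmx // map_mx1.
    rewrite !map_mxM /=.
    have -> : 'X%:M - map_mx polyC (invmx P) *m map_mx polyC D *m map_mx polyC P
       = map_mx polyC (invmx P) *m ('X%:M - map_mx polyC D) *m map_mx polyC P.
      by rewrite mulmxBr mulmxBl scalar_mxC -(mulmxA 'X%:M) PV mulmx1.
    by rewrite !det_mulmx mulrAC -det_mulmx PV det1 mul1r.
  rewrite sim char_poly_trig ?diag_mx_is_trig //.
  by apply: eq_bigr => i _; rewrite mxE eqxx mulr1n mu0E mxE.
exists (sort <=%R [seq mu0 0 i | i : 'I_n]); split.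
  by apply: sort_sorted; exact: le_total.
rewrite (perm_big [seq mu0 0 i | i : 'I_n]) ?perm_sort //= big_image /=.
apply: (map_poly_inj f); rewrite map_char_poly -/A charA rmorph_prod.
by apply: eq_bigr => i _; rewrite rmorphB /= map_polyX map_polyC.
Qed.

Lemma laplacian_spectrum_exists (R : realType) (V E : finType)
  (H : hypergraph V E) : exists mu, is_spectrum (laplacian R H) mu.
Proof.
apply: sym_spectrum_exists; rewrite /laplacian linearB /= tr_diag_mx.
congr (_ - _); apply/matrixP => i j; rewrite !mxE /codegree eq_sym.
congr (if _ then _ else _)%:R; apply: eq_card => e.
by rewrite !inE andbC.
Qed.

Section Code.
(* The ambient space {ffun E -> L} is L^n when E = 'I_n; as L is a field
   extension of F, its {vspace _} are the F-linear (i.e. additive) codes. *)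
Variables (F : finFieldType) (L : fieldExtType F) (E : finType).
Implicit Types (C : {vspace {ffun E -> L}}) (A : {set E}) (c : {ffun E -> L}).

Definition hweight c : nat := #|[set e | c e != 0]|.

Definition is_min_distance C (d : nat) : Prop :=
  (exists c, [/\ c \in C, c != 0 & hweight c = d]) /\
  (forall c, c \in C -> c != 0 -> (d <= hweight c)%N).

Definition coord_fun (e : E) c : L := c e.

Fact coord_fun_linear e : linear (coord_fun e).
Proof. by move=> a u v; rewrite /coord_fun !ffunE. Qed.
HB.instance Definition _ e :=
  GRing.isLinear.Build F {ffun E -> L} L *:%R (coord_fun e) (coord_fun_linear e).

Definition vanishing C A : {vspace {ffun E -> L}} :=
  (C :&: \bigcap_(e in A) lker (linfun (coord_fun e)))%VS.

Lemma vanishingP C A c :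
  reflect (c \in C /\ forall e, e \in A -> c e = 0) (c \in vanishing C A).
Proof.
rewrite memv_cap; apply: (iffP andP) => -[cC cA]; split=> //.
  move=> e eA; move: cA; rewrite memvE => /subv_bigcapP/(_ e eA).
  by rewrite -memvE memv_ker lfunE => /eqP.
rewrite memvE; apply/subv_bigcapP => e eA.
by rewrite -memvE memv_ker lfunE /= /coord_fun cA.
Qed.

Definition code_rank C A : nat := (\dim C - \dim (vanishing C A))%N.

Definition hypergraphic (V : finType) C (H : hypergraph V E) : Prop :=
  (forall e, exists2 c, c \in C & c e != 0) /\
  (forall A, code_rank C A = graphic_rank H A).

End Code.

(* Main.v *)
(* For x = 1_S - (|S|/N) 1, which is orthogonal to the kernel vector 1 of the
   Laplacian L, the Rayleigh quotient bound gives
   mu_2 |S|(N - |S|)/N = mu_2 x.x <= x L x = sum_e |e /\ S| |e \ S|,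
   where only cut edges contribute and each contributes at most floor(r^2/4).
   For the code: dim C = f_H(E) = N - 1, so some nonzero codeword vanishes on A
   iff f_H(A) < N - 1, iff (V, A) is disconnected, iff A misses a cut.  The
   supports of nonzero codewords thus all contain cuts, and every cut contains
   one. *)
Require Import Defs.
From mathcomp Require Import all_boot all_order all_algebra all_field.
From mathcomp Require Import reals.
From mathcomp Require Import sesquilinear spectral complex ring lra zify.

Set Implicit Arguments.
Unset Strict Implicit.
Unset Printing Implicit Defensive.

Import Order.TTheory GRing.Theory Num.Theory.
Local Open Scope ring_scope.

(** * Rayleigh bound for the second eigenvalue of a real symmetric matrix *)

Lemma perm_sorted_second (R : realDomainType) n (d : 'I_n -> R) (mu : seq R) :
  sorted <=%R mu -> perm_eq [seq d i | i : 'I_n] mu -> (0 < n)%N ->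
  exists i0, forall i, i != i0 -> mu`_1 <= d i.
Proof.
move=> mus dmu n0.
have smu : size mu = n by rewrite -(perm_size dmu) size_image card_ord.
have /(perm_iotaP 0)[Is IsP dE] := dmu.
have sIs : size Is = n by rewrite (perm_size IsP) size_iota.
have dI i : d i = mu`_(nth 0%N Is i).
  rewrite -(nth_map 0%N 0) ?sIs // -dE (nth_map i) ?size_enum_ord //.
  by rewrite nth_ord_enum.
have uIs : uniq Is by rewrite (perm_uniq IsP) iota_uniq.
(* [Is] permutes the positions of [mu], so exactly one index is sent to position 0. Every other
   index lands at position 1 or later, even when eigenvalues repeat. *)
have i0lt : (index 0%N Is < n)%N.
  by rewrite -[ltnRHS]sIs index_mem (perm_mem IsP) mem_iota smu n0.
exists (Ordinal i0lt) => i ii0; rewrite dI.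
have Isi0 : (0 < nth 0%N Is i)%N.
  rewrite lt0n; apply: contraNneq ii0 => e.
  by apply/eqP/val_inj; rewrite /= -e index_uniq ?sIs.
have Isin : (nth 0%N Is i < n)%N.
  have : nth 0%N Is i \in Is by rewrite mem_nth ?sIs.
  by rewrite (perm_mem IsP) mem_iota smu add0n.
apply: (sorted_leq_nth le_trans le_refl) => //; rewrite inE smu //.
exact: leq_ltn_trans Isin.
Qed.

Section Spectrum.
Local Open Scope sesquilinear_scope.

(** In the unitary eigenbasis both forms are diagonal: with d the eigenvalues and w the coordinates
    of [z], they are the sums of |w_i|^2 and of d_i |w_i|^2. The only eigenvalue that may lie below
    [m] is the one at [i0], where w vanishes. *)
Lemma hermitian_rayleigh (C : numClosedFieldType) n (A : 'M[C]_n) (i0 : 'I_n)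
    (m : C) (z : 'rV[C]_n) :
  A \is hermsymmx -> (forall i, i != i0 -> m <= spectral_diag A 0 i) ->
  (z *m (spectralmx A)^t*) 0 i0 = 0 ->
  m * (z *m z^t*) 0 0 <= (z *m A *m z^t*) 0 0.
Proof.
move=> Aherm mle z0; set P := spectralmx A in z0.
have Pu : P \is unitarymx := spectral_unitarymx A.
have AE : A = P^t* *m diag_mx (spectral_diag A) *m P.
  by rewrite -invmx_unitary //; apply/orthomx_spectralP/hermitian_normalmx.
set w := z *m P^t* in z0.
have zE : z = w *m P by rewrite /w -invmx_unitary // mulmxKV ?unitarymx_unit.
have wE : P *m z^t* = w^t*.
  by rewrite /w trmx_mul map_mxM trmxCK.
have -> : z *m z^t* = w *m w^t* by rewrite {1}zE -mulmxA wE.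
have -> : z *m A *m z^t* = w *m diag_mx (spectral_diag A) *m w^t*.
  by rewrite {1}AE !mulmxA -/w -!mulmxA wE.
rewrite [(w *m w^t*) _ _]mxE [leRHS]mxE mulr_sumr; apply: ler_sum => i _.
rewrite mul_mx_diag [w^t* _ _]mxE [w^T _ _]mxE [(\matrix_(_, _) _) _ _]mxE.
rewrite mulrAC [leRHS]mulrC.
have [->|/mle md] := eqVneq i i0; first by rewrite z0 !mul0r !mulr0.
by apply: ler_wpM2r => //; exact: mul_conjC_ge0.
Qed.

Variable R : realType.
Local Notation cmx := (map_mx (real_complex R)).

Lemma conj_cmx m n (B : 'M[R]_(m, n)) : (cmx B)^t* = cmx B^T.
Proof. by apply/matrixP => i j; rewrite !mxE; exact: conjc_real. Qed.

Lemma cmx_hermsym n (M : 'M[R]_n) : M^T = M -> cmx M \is hermsymmx.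
Proof.
by move=> Msym; apply/is_hermitianmxP; rewrite expr0 scale1r conj_cmx Msym.
Qed.

Lemma char_poly_similar (K : fieldType) n (P A B : 'M[K]_n) :
  P \in unitmx -> P *m A = B *m P -> char_poly A = char_poly B.
Proof.
move=> Pu PAB; pose PX := map_mx polyC P.
have PX0 : \det PX != 0.
  by rewrite det_map_mx polyC_eq0 -unitfE -unitmxE.
apply: (mulfI PX0); rewrite -det_mulmx [RHS]mulrC -det_mulmx; congr (\det _).
by rewrite mulmxBr mulmxBl -!map_mxM PAB scalar_mxC.
Qed.

Lemma char_poly_spectral_diag (K : numClosedFieldType) n (A : 'M[K]_n) :
  A \is hermsymmx -> char_poly A = \prod_i ('X - (spectral_diag A 0 i)%:P).
Proof.
move=> /hermitian_normalmx/orthomx_spectralP AE.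
have Pu := spectral_unit A.
have PA : spectralmx A *m A = diag_mx (spectral_diag A) *m spectralmx A.
  by rewrite [X in _ *m X = _]AE !mulmxA mulmxV // mul1mx.
rewrite (char_poly_similar Pu PA) char_poly_trig ?diag_mx_is_trig //.
by apply: eq_bigr => i _; rewrite mxE eqxx mulr1n.
Qed.

(** Links the sorted real list [mu] to the unordered complex diagonal: both give the roots of the
    same characteristic polynomial, and a product of monic linear factors determines its roots up to
    order. *)
Lemma spectrum_spectral_diag n (M : 'M[R]_n) mu :
  M^T = M -> is_spectrum M mu -> (0 < n)%N ->
  exists i0, forall i, i != i0 -> (mu`_1)%:C%C <= spectral_diag (cmx M) 0 i.
Proof.
move=> Msym [mus charM] n0; set d := spectral_diag _.
have Mherm := cmx_hermsym Msym.
have dE i : d 0 i = (complex.Re (d 0 i))%:C%C.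
  have /mxOverP/(_ 0 i) := hermitian_spectral_diag_real Mherm.
  by move/RRe_real.
have dmu : perm_eq [seq complex.Re (d 0 i) | i : 'I_n] mu.
  apply: prod_XsubC_eq; rewrite -charM.
  apply: (map_poly_inj (real_complex R)).
  rewrite map_char_poly char_poly_spectral_diag // rmorph_prod big_image /=.
  apply: eq_bigr => i _; rewrite rmorphB /= map_polyX map_polyC.
  by congr ('X - _%:P); exact/esym/dE.
have [i0 i0P] := perm_sorted_second mus dmu n0.
by exists i0 => i /i0P; rewrite dE lecR.
Qed.

(* A suitable combination of [u] and [x] has no component along the
   eigenvector of the smallest eigenvalue. *)
Lemma second_eigenvalue_rayleigh n (M : 'M[R]_n) mu (u x : 'rV[R]_n) :
  M^T = M -> is_spectrum M mu -> 0 < mu`_1 ->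
  u *m M = 0 -> u != 0 -> x *m u^T = 0 ->
  mu`_1 * (x *m x^T) 0 0 <= (x *m M *m x^T) 0 0.
Proof.
move=> Msym Mmu mu1 uM u0 xu.
have n0 : (0 < n)%N.
  rewrite lt0n; apply: contraNneq u0 => n0; apply/eqP/rowP => i.
  by have := ltn_ord i; rewrite [X in (_ < X)%N]n0.
have [i0 i0P] := spectrum_spectral_diag Msym Mmu n0.
have Mherm := cmx_hermsym Msym.
set P := spectralmx (cmx M).
pose p (y : 'rV[R]_n) : R[i] := (cmx y *m P^t*) 0 i0.
(* With a = p(x) and b = -p(u), linearity gives p(au + bx) = p(x)p(u) - p(u)p(x) = 0. *)
pose a := p x; pose b : R[i] := - p u.
pose z := a *: cmx u + b *: cmx x.
have zP : (z *m P^t*) 0 i0 = 0.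
  rewrite /z mulmxDl -!scalemxAl [LHS]mxE [X in X + _]mxE [X in _ + X]mxE.
  rewrite -/(p u) -/(p x).
  by rewrite mulNr mulrC subrr.
have zT : z^t* = a^* *: cmx u^T + b^* *: cmx x^T.
  by rewrite linearD !linearZ /= map_mxD !map_mxZ !conj_cmx.
have ux : u *m x^T = 0 by rewrite -[LHS]trmxK trmx_mul trmxK xu trmx0.
have xMu : x *m M *m u^T = 0.
  by rewrite -mulmxA -[M *m _]trmxK trmx_mul trmxK Msym uM trmx0 mulmx0.
have zz : z *m z^t* = (a * a^*) *: cmx (u *m u^T) + (b * b^*) *: cmx (x *m x^T).
  rewrite zT /z mulmxDr !mulmxDl -!scalemxAl -!scalemxAr -!map_mxM ux xu.
  by rewrite !map_mx0 !scaler0 addr0 add0r !scalerA.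
have zMz : z *m cmx M *m z^t* = (b * b^*) *: cmx (x *m M *m x^T).
  rewrite zT /z !mulmxDl -!scalemxAl -!map_mxM uM map_mx0 mul0mx scaler0 add0r.
  rewrite mulmxDr -!scalemxAr -!map_mxM xMu.
  by rewrite map_mx0 scaler0 add0r !scalerA.
have uu : 0 < (u *m u^T) 0 0.
  rewrite lt_neqAle; apply/andP; split; last first.
    by rewrite mxE sumr_ge0 // => i _; rewrite mxE -expr2 sqr_ge0.
  apply: contraNneq u0 => /esym/eqP; rewrite mxE psumr_eq0; last first.
    by move=> i _; rewrite mxE -expr2 sqr_ge0.
  move=> /allP u0; apply/eqP/rowP => i; apply/eqP.
  by have := u0 i (mem_index_enum _); rewrite !mxE mulf_eq0 orbb.
(* If p(u) were 0, the Rayleigh bound would apply to [u] itself and give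
   [mu]_1[|u|^2 <= 0, against the positivity of]mu[_1]. *)
have b0 : b != 0.
  rewrite oppr_eq0; apply/eqP => /(hermitian_rayleigh Mherm i0P).
  rewrite conj_cmx -!map_mxM uM mul0mx [X in _ * X]mxE map_mx0 [leRHS]mxE.
  by rewrite -rmorphM lecR leNgt mulr_gt0.
have bb : 0 < b * b^* by rewrite mul_conjC_gt0.
have := hermitian_rayleigh Mherm i0P zP.
rewrite zz zMz [X in _ * X]mxE [X in X + _]mxE [X in _ + X]mxE [leRHS]mxE.
rewrite ![(cmx _) 0 0]mxE.
(* As [u] is in the kernel and orthogonal to [x], the bound for z has no mixed terms. Dropping the
   nonnegative |a|^2 term on the left and dividing by |b|^2 leaves the bound for [x]. *)
rewrite mulrDr mulrCA [X in _ + X]mulrCA => le_aabb.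
rewrite -lecR rmorphM -(ler_pM2l bb); apply: le_trans le_aabb.
rewrite lerDr mulr_ge0 ?mul_conjC_ge0 // -rmorphM ler0c.
by rewrite mulr_ge0 // ltW.
Qed.

End Spectrum.

(** * Quadratic form of the Laplacian at indicator vectors *)

Lemma codegreeC (V E : finType) (H : hypergraph V E) u v :
  codegree H u v = codegree H v u.
Proof.
rewrite /codegree eq_sym; congr (if _ then _ else _).
by apply: eq_card => e; rewrite !inE andbC.
Qed.

(** By the arithmetic-geometric mean inequality 4ab <= (a + b)^2; since ab is an integer, the
    quotient may be rounded down. *)
Lemma mul_leq_sqr_div4 a b r : (a + b <= r)%N -> (a * b <= r ^ 2 %/ 4)%N.
Proof.
move=> abr; rewrite leq_divRL // mulnC.
by apply: leq_trans (nat_AGM2 a b) _; rewrite leq_exp2r.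
Qed.

Section LaplacianForm.
Variables (R : comNzRingType) (V E : finType) (H : hypergraph V E).
Implicit Types S : {set V}.

Definition indicator_row S : 'rV[R]_#|V| := \row_i (enum_val i \in S)%:R.

Lemma laplacian_sym : (laplacian R H)^T = laplacian R H.
Proof.
rewrite /laplacian linearB /= tr_diag_mx; congr (_ - _).
by apply/matrixP => i j; rewrite !mxE codegreeC.
Qed.

Lemma sum_enum_val (f : V -> R) : \sum_(i < #|V|) f (enum_val i) = \sum_v f v.
Proof. by rewrite -big_enum_val. Qed.

Lemma indicator_rowM S T :
  (indicator_row S *m (indicator_row T)^T) 0 0 = #|S :&: T|%:R.
Proof.
rewrite mxE -sum1_card natr_sum [RHS]big_mkcond -[RHS]sum_enum_val.
apply: eq_bigr => i _; rewrite !mxE inE.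
by case: (_ \in S); case: (_ \in T); rewrite /= ?mulr0 ?mul0r ?mulr1.
Qed.

Lemma indicator_row_laplacian S i :
  (indicator_row S *m laplacian R H) 0 i =
  \sum_v (codegree H (enum_val i) v)%:R *
    ((enum_val i \in S)%:R - (v \in S)%:R).
Proof.
rewrite /laplacian mulmxBr mul_mx_diag !mxE.
(* The diagonal codegree is 0, so the degree may be summed over all vertices. *)
have -> : \sum_(v | v != enum_val i) (codegree H (enum_val i) v)%:R =
          \sum_v (codegree H (enum_val i) v)%:R :> R.
  by rewrite [RHS](bigD1 (enum_val i)) //= /codegree eqxx add0r.
have -> : \sum_j indicator_row S 0 j * adjacency_mx R H j i =
          \sum_v (v \in S)%:R * (codegree H v (enum_val i))%:R.
  by rewrite -sum_enum_val; apply: eq_bigr => j _; rewrite !mxE.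
rewrite mulr_sumr -sumrB; apply: eq_bigr => v _.
by rewrite mulrBr ![_%:R * (_ \in _)%:R]mulrC (codegreeC H v).
Qed.

Lemma indicator_setT_laplacian : indicator_row setT *m laplacian R H = 0.
Proof.
apply/rowP => i; rewrite indicator_row_laplacian mxE big1 // => v _.
by rewrite !inE subrr mulr0.
Qed.

(** Double counting: both sides count triples (u, v, e) with u, v in e, u in [S] and v outside
    [S]. *)
Lemma indicator_laplacian_form S :
  (indicator_row S *m laplacian R H *m (indicator_row S)^T) 0 0 =
  (\sum_e #|H e :&: S| * #|H e :&: ~: S|)%N%:R.
Proof.
pose a u v : R := (codegree H u v)%:R.
transitivity (\sum_u \sum_v (u \in S)%:R * (v \notin S)%:R * a u v).
  rewrite mxE -sum_enum_val; apply: eq_bigr => i _.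
  rewrite indicator_row_laplacian mulr_suml; apply: eq_bigr => v _.
  rewrite !mxE -/(a _ _); case: (_ \in S); case: (_ \in S); rewrite /=; ring.
have card01 (e : E) (T : {set V}) :
    #|H e :&: T|%:R = \sum_u (u \in T)%:R * (u \in H e)%:R :> R.
  rewrite -sum1_card natr_sum [LHS]big_mkcond; apply: eq_bigr => u _.
  by rewrite inE; case: (u \in T); case: (u \in H e); rewrite /= ?mulr0 ?mulr1.
transitivity (\sum_u \sum_v \sum_e
    ((u \in S)%:R * (u \in H e)%:R) * ((v \in ~: S)%:R * (v \in H e)%:R) : R).
  apply: eq_bigr => u _; apply: eq_bigr => v _.
  (* For u = v the codegree is 0 by convention, and the right side agrees since no vertex is in both
     [S] and its complement. *)
  rewrite /a /codegree in_setC; case: eqVneq => [->|_].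
    by rewrite mulr0 big1 // => e _; case: (v \in S); rewrite ?mul0r ?mulr0.
  rewrite -sum1_card natr_sum big_mkcond mulr_sumr; apply: eq_bigr => e _.
  rewrite inE; case: (u \in H e); case: (v \in H e); rewrite /=; ring.
rewrite natr_sum.
under [RHS]eq_bigr => e _.
  rewrite natrM !card01 mulr_suml.
  under eq_bigr => u _ do rewrite mulr_sumr.
  over.
rewrite [RHS]exchange_big; apply: eq_bigr => u _; exact: exchange_big.
Qed.

End LaplacianForm.

Lemma cut_sum_le V E (H : hypergraph V E) r (S : {set V}) :
  (forall e, (#|H e| <= r)%N) ->
  (\sum_e #|H e :&: S| * #|H e :&: ~: S| <= #|cut H S| * (r ^ 2 %/ 4))%N.
Proof.
move=> Hr; rewrite -sum_nat_const [leqRHS]big_mkcond.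
apply: leq_sum => e _; rewrite inE -!card_gt0.
case: (posnP #|H e :&: S|) => [->//|_].
case: (posnP #|H e :&: ~: S|) => [->|_] /=.
  by rewrite muln0.
by apply: mul_leq_sqr_div4; rewrite -setDE cardsID.
Qed.

(** * Components, cuts and edge connectivity *)

Section Cuts.
Variables V E : finType.
Implicit Types (H : hypergraph V E) (A : {set E}) (S : {set V}).

(** An edge outside the cut lies wholly in [S] or wholly in its complement, so a step along it
    cannot change sides. *)
Lemma adj_cut_disjoint H A S u v :
  [disjoint cut H S & A] -> adj H A u v -> (u \in S) = (v \in S).
Proof.
move=> dis /existsP[e /and3P[eA ue ve]].
have : e \notin cut H S by rewrite (disjointFl dis eA).
rewrite inE negb_and !negbK => /orP[] /eqP/setP eS.
  by have := eS u; have := eS v; rewrite !inE ue ve /= => -> ->.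
by have := eS u; have := eS v; rewrite !inE ue ve /= => /negbFE -> /negbFE ->.
Qed.

Lemma kappa_gt1P H A :
  reflect (exists S, [/\ S != set0, S != setT & [disjoint cut H S & A]])
          (1 < kappa H A)%N.
Proof.
have symA := adj_connect_sym H A.
apply: (iffP card_gt1P) => [[u [v [ur vr uv]]]|[S [S0 ST dis]]].
  move: ur vr; rewrite !inE /= !andbT => /eqP ur /eqP vr.
  (* The component of u serves as [S]: an edge of [A] leaving it would enlarge it. *)
  exists [set w | connect (adj H A) u w]; split.
  - by apply/set0Pn; exists u; rewrite inE.
  - apply: contraNneq uv => /setP/(_ v); rewrite !inE => uv.
    by rewrite -ur -vr root_connect.
  rewrite disjoint_subset; apply/subsetP => e; rewrite !inE => /andP[].
  move=> /set0Pn[x /setIP[xe]]; rewrite inE => ux /set0Pn[y /setIP[ye]].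
  rewrite !inE; apply: contra => eA; apply: connect_trans ux (connect1 _).
  by apply/existsP; exists e; rewrite eA xe.
have [u uS] := set0Pn _ S0.
have /set0Pn[v] : ~: S != set0.
  by apply: contraNneq ST => S0'; rewrite -[S]setCK S0' setC0.
rewrite inE => vS.
(* Conversely, [S] is a union of components, so vertices on its two sides have distinct roots. *)
exists (fingraph.root (adj H A) u), (fingraph.root (adj H A) v).
rewrite !inE !andbT.
split; try exact: roots_root.
rewrite root_connect //; apply: contraNN vS.
have cl : closed (adj H A) (mem S) by move=> x y /(adj_cut_disjoint dis).
by move=> /(closed_connect cl) /= <-.
Qed.

Lemma edge_connectivity_le H S :
  S != set0 -> S != setT -> (edge_connectivity H <= #|cut H S|)%N.
Proof.
move=> S0 ST; rewrite /edge_connectivity -minEnat -leEnat.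
by apply: bigmin_le_cond; rewrite S0.
Qed.

Lemma edge_connectivity_attained H :
  (1 < #|V|)%N ->
  exists S, [/\ S != set0, S != setT & #|cut H S| = edge_connectivity H].
Proof.
move=> /card_gt1P[u [v [_ _ uv]]].
have u0 : [set u] != set0 by apply/set0Pn; exists u; rewrite inE.
have uT : [set u] != setT.
  by apply: contraNneq uv => /setP/(_ v); rewrite !inE eq_sym.
case: (@arg_minnP _ [set u] (fun S => (S != set0) && (S != setT))
  (fun S => #|cut H S|)) => [|S /andP[S0 ST] Smin]; first by rewrite u0.
exists S; split=> //; apply/eqP; rewrite eqn_leq edge_connectivity_le // andbT.
(* The smallest cut is also at most the default value [#|E|] of the minimum, so the default does no
   harm. *)
rewrite /edge_connectivity; elim/big_ind: _ => // [|x y xS yS].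
  exact: max_card.
by rewrite leq_min xS.
Qed.

End Cuts.

(** * Minimum distance of hypergraphic codes *)

Section MinimumDistance.
Variables (V E : finType) (F : finFieldType) (L : fieldExtType F).
Variables (H : hypergraph V E) (C : {vspace {ffun E -> L}}).
Hypotheses (Hconn : hconnected H) (HV : (2 <= #|V|)%N) (CH : hypergraphic C H).

(** Only the zero word vanishes at every coordinate, so the dimension is the rank of the full edge
    set, which connectedness fixes. *)
Lemma hypergraphic_dim : \dim C = #|V|.-1.
Proof.
case: CH => _ /(_ setT); rewrite /code_rank /graphic_rank Hconn subn1 => <-.
suff -> : vanishing C setT = 0%VS by rewrite dimv0 subn0.
apply/eqP; rewrite -subv0; apply/subvP => c /vanishingP[_ c0].
by rewrite memv0; apply/eqP/ffunP => e; rewrite ffunE c0 ?inE.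
Qed.

(** Subtracting the rank |V| - kappa(A) from the dimension |V| - 1 shows that the words vanishing on
    [A] form a space of dimension kappa(A) - 1. *)
Lemma vanishing_neq0 A : (vanishing C A != 0%VS) = (1 < kappa H A)%N.
Proof.
rewrite -dimv_eq0 -lt0n; have := hypergraphic_dim; case: CH => _ /(_ A).
have : (\dim (vanishing C A) <= \dim C)%N by rewrite dimvS ?capvSl.
rewrite /code_rank /graphic_rank; lia.
Qed.

Lemma hypergraphic_min_distance : is_min_distance C (edge_connectivity H).
Proof.
have lb c : c \in C -> c != 0 -> (edge_connectivity H <= hweight c)%N.
  (* [A] is the zero set of c, so a cut disjoint from [A] lies in the support of c. *)
  move=> cC c0; pose A := [set e | c e == 0].
  have : vanishing C A != 0%VS.
    apply: contraNneq c0 => A0; rewrite -memv0 -A0.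
    by apply/vanishingP; split=> // e; rewrite inE => /eqP.
  rewrite vanishing_neq0 => /kappa_gt1P[S [S0 ST dis]].
  apply: leq_trans (edge_connectivity_le H S0 ST) (subset_leq_card _).
  by apply/subsetP => e eS; have := disjointFr dis eS; rewrite !inE => ->.
split=> //; have [S [S0 ST cutS]] := edge_connectivity_attained H HV.
(* A nonzero word vanishing off a minimum cut has its support inside that cut. *)
have : vanishing C (~: cut H S) != 0%VS.
  rewrite vanishing_neq0; apply/kappa_gt1P; exists S.
  by split=> //; rewrite -setI_eq0 setICr.
rewrite -vpick0; set c := vpick _ => c0.
have /vanishingP[cC cA] := memv_pick (vanishing C (~: cut H S)).
exists c; split=> //; apply/eqP; rewrite eqn_leq lb // andbT -cutS.
apply: subset_leq_card; apply/subsetP => e; rewrite inE.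
by apply: contraR => eS; rewrite cA ?eqxx ?in_setC.
Qed.

End MinimumDistance.

(** * Spectral lower bound on cuts *)

Section CutBound.
Variables (R : realType) (V E : finType) (H : hypergraph V E) (mu : seq R).
Hypotheses (HV : (0 < #|V|)%N) (Hmu : is_spectrum (laplacian R H) mu).

Lemma second_eigenvalue_indicator (S : {set V}) : 0 < mu`_1 ->
  mu`_1 * (#|S|%:R * (#|V|%:R - #|S|%:R) / #|V|%:R) <=
  (\sum_e #|H e :&: S| * #|H e :&: ~: S|)%N%:R.
Proof.
move=> mu1; have N0 : #|V|%:R != 0 :> R by rewrite pnatr_eq0 -lt0n.
pose y : 'rV[R]_#|V| := indicator_row R S.
pose u : 'rV[R]_#|V| := indicator_row R setT.
(* The mean of the entries of [y]; subtracting [c *: u] makes the vector orthogonal to the all-ones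
   row [u]. *)
pose c : R := #|S|%:R / #|V|%:R.
have uu : u *m u^T = (#|V|%:R)%:M.
  by rewrite [LHS]mx11_scalar indicator_rowM setIT cardsT.
have yu : y *m u^T = (#|S|%:R)%:M.
  by rewrite [LHS]mx11_scalar indicator_rowM setIT.
have uy : u *m y^T = (#|S|%:R)%:M.
  by rewrite [LHS]mx11_scalar indicator_rowM setTI.
have yy : y *m y^T = (#|S|%:R)%:M.
  by rewrite [LHS]mx11_scalar indicator_rowM setIid.
have uL : u *m laplacian R H = 0 := indicator_setT_laplacian R H.
have Lu : laplacian R H *m u^T = 0.
  by rewrite -[LHS]trmxK trmx_mul trmxK laplacian_sym uL trmx0.
have u0 : u != 0.
  apply: contraNneq N0 => u0; move: uu; rewrite u0 mul0mx => /matrixP/(_ 0 0).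
  by rewrite !mxE eqxx mulr1n => <-.
have xu : (y - c *: u) *m u^T = 0.
  rewrite mulmxBl -scalemxAl uu yu scale_scalar_mx -raddfB /=.
  by rewrite divfK // subrr raddf0.
have xT : (y - c *: u)^T = y^T - c *: u^T by rewrite linearB linearZ.
have := second_eigenvalue_rayleigh (laplacian_sym R H) Hmu mu1 uL u0 xu.
have -> : (y - c *: u) *m (y - c *: u)^T =
          (#|S|%:R * (#|V|%:R - #|S|%:R) / #|V|%:R)%:M.
  rewrite xT mulmxBr -scalemxAr xu scaler0 subr0 mulmxBl.
  rewrite -scalemxAl yy uy scale_scalar_mx -raddfB /=; congr (_%:M).
  by rewrite /c; field.
(* The Laplacian kills [u] from either side, so the shift leaves the form unchanged. *)
have -> : (y - c *: u) *m laplacian R H *m (y - c *: u)^T =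
          y *m laplacian R H *m y^T.
  rewrite mulmxBl -scalemxAl uL scaler0 subr0 xT mulmxBr.
  by rewrite -scalemxAr -[_ *m u^T]mulmxA Lu mulmx0 scaler0 subr0.
by rewrite indicator_laplacian_form mxE eqxx mulr1n.
Qed.

Lemma spectral_cut_bound r (S : {set V}) :
  (1 < r)%N -> (forall e, (#|H e| <= r)%N) ->
  mu`_1 / (r ^ 2 %/ 4)%N%:R *
    (#|S|%:R * (#|V|%:R - #|S|%:R) / #|V|%:R) <= #|cut H S|%:R.
Proof.
move=> r2 Hr; have r0 : 0 < (r ^ 2 %/ 4)%N%:R :> R.
  by rewrite ltr0n divn_gt0 // (@leq_exp2r 2 r 2).
have SV : 0 <= #|S|%:R * (#|V|%:R - #|S|%:R) / #|V|%:R :> R.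
  by rewrite divr_ge0 // mulr_ge0 // subr_ge0 ler_nat max_card.
(* A nonpositive [mu]_1[makes the left side nonpositive. This also covers a single vertex,
   where]mu[_1] is the default 0. *)
have [mu0|mu1] := lerP mu`_1 0.
  apply: le_trans (ler0n _ _); rewrite -mulrA mulr_le0_ge0 //.
  by rewrite mulr_ge0 // invr_ge0 ltW.
rewrite mulrAC ler_pdivrMr // -natrM.
apply: le_trans (second_eigenvalue_indicator S mu1) _.
by rewrite ler_nat cut_sum_le.
Qed.

End CutBound.

Theorem theorem6p2 (R : realType) (V E : finType) (H : hypergraph V E)
    (r : nat) (mu : seq R)
    (Hconn : hconnected H) (HV : (2 <= #|V|)%N) (Hr : (2 <= r)%N)
    (Hrank : forall e : E, (#|H e| <= r)%N)
    (Hmu : is_spectrum (laplacian R H) mu) :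
  (forall S : {set V}, S != set0 -> S != [set: V] ->
     mu`_1 / (r ^ 2 %/ 4)%N%:R *
       (#|S|%:R * (#|V|%:R - #|S|%:R) / #|V|%:R) <= #|cut H S|%:R) /\
  (forall (F : finFieldType) (L : fieldExtType F)
      (C : {vspace {ffun E -> L}}),
     hypergraphic C H ->
     is_min_distance C (edge_connectivity H) /\
     Num.ceil (mu`_1 * (#|V|%:R - 1) / (#|V|%:R * (r ^ 2 %/ 4)%N%:R))
       <= (edge_connectivity H)%:Z).

Proof.
have V0 : (0 < #|V|)%N by apply: leq_trans HV.
have bound S := spectral_cut_bound V0 Hmu S Hr Hrank.
split=> [S _ _ //|F L C CH]; split; first exact: hypergraphic_min_distance CH.
rewrite ceil_le_int; have [S [S0 ST cutS]] := edge_connectivity_attained H HV.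
have N0 : 0 < #|V|%:R :> R by rewrite ltr0n.
have r0 : 0 < (r ^ 2 %/ 4)%N%:R :> R.
  by rewrite ltr0n divn_gt0 // (@leq_exp2r 2 r 2).
have [mu0|mu1] := lerP mu`_1 0.
  apply: le_trans (ler0n _ _); rewrite -mulrA mulr_le0_ge0 // divr_ge0 //.
    by rewrite subr_ge0 ler1n.
  by rewrite mulr_ge0 // ltW.
(* At a minimum cut with s = |S|, it remains to show N - 1 <= s(N - s), which holds because 1 <= s
   <= N - 1. *)
rewrite -cutS; apply: le_trans (bound S).
have -> : mu`_1 * (#|V|%:R - 1) / (#|V|%:R * (r ^ 2 %/ 4)%N%:R) =
    mu`_1 / (r ^ 2 %/ 4)%N%:R * ((#|V|%:R - 1) / #|V|%:R).
  by field; rewrite !gt_eqF.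
rewrite ler_pM2l ?divr_gt0 // ler_pM2r ?invr_gt0 //.
have s1 : 1 <= #|S|%:R :> R by rewrite ler1n card_gt0.
have s2 : #|S|%:R + 1 <= #|V|%:R :> R.
  by rewrite natr1 ler_nat -cardsT proper_card // properEneq ST subsetT.
(* N - 1 = s (N - s) - (s - 1) (N - s - 1) *)
rewrite -subr_ge0 (_ : _ - _ =
  (#|S|%:R - 1) * (#|V|%:R - #|S|%:R - 1)); last by ring.
by rewrite mulr_ge0 //; lra.
Qed.
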